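(* Let $p>5$ be a prime. Then for every integer $a\in\mathbb{Z}$, $$\sum_{k=0}^{p-1}(-1)^{ak}\binom{p-1}{k}^a\equiv \frac{(a-1)p}{ap-1}\left(1+\frac{a(a+1)(3a-2)}{6}\,p^3 X_p\right)\pmod{p^6},$$ where $X_p=\frac{B_{p-3}}{p-3}-\frac{B_{2p-4}}{4p-8}$ and $B_n$ denotes the $n$-th Bernoulli number.
   Context: For negative $a$, $\binom{p-1}{k}^a$ means $1/\binom{p-1}{k}^{|a|}$. A congruence between rational numbers modulo $p^6$ means that their difference is a rational number whose $p$-adic valuation is at least $6$ (all quantities involved have denominators prime to $p$). *)

(* Defs.v *)
From HB Require Import structures.
From mathcomp Require Import all_boot all_order all_algebra.

Set Implicit Arguments.
Unset Strict Implicit.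
Unset Printing Implicit Defensive.

Import Order.TTheory GRing.Theory Num.Theory.
Local Open Scope ring_scope.

(* [:: B_0; ...; B_(n-1)], each new term being given by the recurrence
   B_n = [n = 0] - 1 / (n + 1) * \sum_(k < n) 'C(n + 1, k) B_k,
   i.e. the convention B_1 = - 1/2. *)
Fixpoint bernoulli_seq (n : nat) : seq rat :=
  if n is m.+1 then
    let s := bernoulli_seq m in
    rcons s ((m == 0%N)%:R - (m.+1)%:R^-1 * \sum_(k < m) 'C(m.+1, k)%:R * s`_k)
  else [::].

Definition bernoulli (n : nat) : rat := (bernoulli_seq n.+1)`_n.

Lemma size_bernoulli_seq n : size (bernoulli_seq n) = n.
Proof. by elim: n => //= n IHn; rewrite size_rcons IHn. Qed.

Lemma nth_bernoulli_seq n k : (k < n)%N -> (bernoulli_seq n)`_k = bernoulli k.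
Proof.
elim: n => //= n IHn; rewrite ltnS leq_eqVlt => /predU1P[-> //|lt_kn].
by rewrite nth_rcons size_bernoulli_seq lt_kn IHn.
Qed.

Lemma bernoulli_rec n :
  \sum_(k < n.+1) 'C(n.+1, k)%:R * bernoulli k = (n == 0%N)%:R.
Proof.
have En : bernoulli n = (n == 0%N)%:R
    - (n.+1)%:R^-1 * \sum_(k < n) 'C(n.+1, k)%:R * bernoulli k.
  rewrite {1}/bernoulli /= nth_rcons size_bernoulli_seq ltnn eqxx.
  by under eq_bigr => k _ do rewrite nth_bernoulli_seq //.
have nz : (n.+1)%:R != 0 :> rat by rewrite pnatr_eq0.
rewrite big_ord_recr /= binSn En mulrBr mulrA divff // mul1r addrC subrK.
by case: n {En nz} => [|n]; rewrite ?mulr1 ?mulr0.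
Qed.

(* Only meaningful for x != 0: the junk value at 0 is 0. *)
Definition padic_val (p : nat) (x : rat) : int :=
  (logn p `|numq x|%N)%:Z - (logn p `|denq x|%N)%:Z.

(* x = y is a separate case, as the valuation of 0 is infinite. *)
Definition eqmod_ppow (p m : nat) (x y : rat) : Prop :=
  x = y \/ m%:Z <= padic_val p (x - y).

Definition X_ (p : nat) : rat :=
  bernoulli (p - 3) / (p%:R - 3%:R)
  - bernoulli (2 * p - 4) / (4%:R * p%:R - 8%:R).

(* Main.v *)
(* With u_k = (-1)^k C(p-1,k) = prod_(j <= k) (1 - p/j), put S(a) = sum_k u_k^a and
   T_j(a) = sum_(0 < k < p) u_k^a / k^j. Abel summation of 1 against u_k^a expresses
   (1 - ap) S(a) - (1 - a) p modulo p^6 through T_1, ..., T_4, while the reflection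
   k -> p - k, under which u_(p-k) = u_(k-1), gives T_3 = 0 mod p^2 and
   T_1 = - (a+1)/2 p T_2 mod p^4. Only T_2 modulo p^3 remains:
     (1 - ap) S(a) = (1 - a) p + a (a+1) (1-a) / 12 p^3 T_2(a)  mod p^6.
   As u_k = 1 mod p, T_2(a) mod p^3 is a quadratic polynomial in a, which is found by
   interpolation: T_2(0) = H with H = sum_(0 < k < p) 1/k^2, T_2(1) = - H/2 by the
   classical binomial transform, and T_2(2) = - 2H since S(2) = C(2p-2,p-1) (Vandermonde)
   and C(2p-1,p-1) = prod_j (1 - p^2/j^2) = 1 - p^2 H mod p^5.
   Finally H = - 4 p X_p mod p^3. For P(n) = sum_(0 < k < p) k^n, n any integer, reducing
   2k modulo p gives (2^n - 1) P(n) / n modulo p^3 in a form from which the second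
   difference of P(n)/n along n = -2, p-3, 2p-4 is seen to vanish mod p^3; and
   P(n) = p B_n mod p^3 for the last two exponents. *)

From HB Require Import structures.
Require Import Defs.
From mathcomp Require Import all_boot all_order all_algebra.
From mathcomp Require Import cyclic ring zify.

Import Order.TTheory GRing.Theory Num.Theory.
Local Open Scope ring_scope.

(** * Rationals integral at p *)

Definition pint (p : nat) : {pred rat} := fun x => coprime p `|denq x|%N.

(** By Gauss's lemma the reduced denominator divides [d], so a fraction can be treated without
    reducing it first. *)
Lemma pint_frac (p d : nat) (n : int) :
  (0 < d)%N -> coprime p d -> (n%:~R / d%:R : rat) \in pint p.
Proof.
move=> d0 cop; set x : rat := _ / _.
have e : (numq x * d%:Z = n * denq x)%R.
  apply: (@intr_inj rat); rewrite !rmorphM /= numqE /x -pmulrn.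
  have d1 : (d%:R : rat) != 0 by rewrite pnatr_eq0 -lt0n.
  by field.
rewrite unfold_in; apply: coprime_dvdr cop.
rewrite -(@Gauss_dvdr _ `|numq x|); last by rewrite coprime_sym coprime_num_den.
have -> : (`|numq x| * d = `|n| * `|denq x|)%N by rewrite -abszM -e abszM.
exact: dvdn_mull.
Qed.

Lemma pint_subring (p : nat) : GRing.subring_closed (pint p).
Proof.
have den x : exists2 d : nat, (0 < d)%N & d%:Z = denq x.
  by exists `|denq x|%N; rewrite ?absz_denq // absz_gt0.
have E x : x = (numq x)%:~R / (denq x)%:~R by rewrite divq_num_den.
split.
- by rewrite unfold_in /= coprimen1.
- move=> x y; rewrite !unfold_in => cx cy.
  have [dx dx0 ex] := den x; have [dy dy0 ey] := den y.
  have -> : x - y = (numq x * dy%:Z - numq y * dx%:Z)%:~R / (dx * dy)%:R.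
    rewrite {1}[x]E {1}[y]E -ex -ey rmorphB !rmorphM /= -!pmulrn.
    have dx1 : (dx%:R : rat) != 0 by rewrite pnatr_eq0 -lt0n.
    have dy1 : (dy%:R : rat) != 0 by rewrite pnatr_eq0 -lt0n.
    by field; rewrite dx1 dy1.
  apply: pint_frac; rewrite ?muln_gt0 ?dx0 // coprimeMr.
  by move: cx cy; rewrite -ex -ey /= => -> ->.
- move=> x y; rewrite !unfold_in => cx cy.
  have [dx dx0 ex] := den x; have [dy dy0 ey] := den y.
  have -> : x * y = (numq x * numq y)%:~R / (dx * dy)%:R.
    rewrite {1}[x]E {1}[y]E -ex -ey !rmorphM /= -!pmulrn.
    have dx1 : (dx%:R : rat) != 0 by rewrite pnatr_eq0 -lt0n.
    have dy1 : (dy%:R : rat) != 0 by rewrite pnatr_eq0 -lt0n.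
    by field; rewrite dx1 dy1.
  apply: pint_frac; rewrite ?muln_gt0 ?dx0 // coprimeMr.
  by move: cx cy; rewrite -ex -ey /= => -> ->.
Qed.

HB.instance Definition _ (p : nat) :=
  GRing.isSubringClosed.Build rat (pint p) (pint_subring p).

(** Descends through the ring operations and leaves inverses to the context. Hence the witnesses
    below write 1/6 or 1/24 as products of [2^-1], [3^-1] and [5^-1]. *)
Ltac pint :=
  try assumption;
  lazymatch goal with
  | |- is_true (_ + _ \in _) => apply: rpredD; pint
  | |- is_true (- _ \in _) => rewrite rpredN; pint
  | |- is_true (_ * _ \in _) => apply: rpredM; pint
  | |- is_true (_ ^+ _ \in _) => apply: rpredX; pint
  | |- is_true (0 \in _) => exact: rpred0
  | |- is_true (1 \in _) => exact: rpred1
  | |- is_true (_%:R \in _) => exact: rpred_nat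
  | |- is_true (_%:~R \in _) => exact: rpred_int
  | |- _ => idtac
  end.

Lemma pint_invn (p d : nat) : (0 < d)%N -> coprime p d -> (d%:R^-1 : rat) \in pint p.
Proof. by move=> d0 cd; rewrite -[_^-1]mul1r; apply: (pint_frac _ d 1). Qed.

Lemma pint_invz (p : nat) (n : int) :
  n != 0 -> coprime p `|n|%N -> (n%:~R^-1 : rat) \in pint p.
Proof.
move=> n0 cn; case: (intP n) n0 cn => [//|m|m] _ cn.
  by apply: pint_invn.
by rewrite rmorphN invrN rpredN; apply: pint_invn; rewrite abszN in cn.
Qed.

Lemma pint_expz (p : nat) (x : rat) (a : int) :
  x \in pint p -> x^-1 \in pint p -> x ^ a \in pint p.
Proof.
by move=> hx hi; case: (intP a) => [|n|n]; rewrite ?expr0z ?rpred1 //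
  -?exprnP -?exprnN -?exprVn; pint.
Qed.

(** * Congruences between rationals modulo p^m *)

(** The explicit witness turns a congruence into an equation to rewrite with, so that [ring] and
    [field] do the bookkeeping. *)
Definition cong (p m : nat) (x y : rat) : Prop :=
  exists2 z, z \in pint p & x = y + p%:R ^+ m * z.

Section Congruence.

Variable p : nat.

Lemma cong_refl m x : cong p m x x.
Proof. by exists 0; rewrite ?rpred0 // mulr0 addr0. Qed.

Lemma cong_sym m x y : cong p m x y -> cong p m y x.
Proof. by case=> z hz ->; exists (- z); [pint | ring]. Qed.

Lemma cong_trans m y x z : cong p m x y -> cong p m y z -> cong p m x z.
Proof. by case=> u hu -> [v hv ->]; exists (u + v); [pint | ring]. Qed.

Lemma cong_add m x y x' y' :
  cong p m x y -> cong p m x' y' -> cong p m (x + x') (y + y').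
Proof. by case=> u hu -> [v hv ->]; exists (u + v); [pint | ring]. Qed.

Lemma cong_mull m c x y : c \in pint p -> cong p m x y -> cong p m (c * x) (c * y).
Proof. by move=> hc [u hu ->]; exists (c * u); [pint | ring]. Qed.

Lemma cong_weaken m n x y : (n <= m)%N -> cong p m x y -> cong p n x y.
Proof.
move=> le [z hz ->]; exists (p%:R ^+ (m - n) * z); first by pint.
by rewrite mulrA -exprD subnKC.
Qed.

Lemma cong_sum m (I : Type) (r : seq I) (P : pred I) (F G : I -> rat) :
  (forall i, P i -> cong p m (F i) (G i)) ->
  cong p m (\sum_(i <- r | P i) F i) (\sum_(i <- r | P i) G i).
Proof.
move=> h; elim/big_rec2: _ => [|i x y Pi]; first exact: cong_refl.
by apply: cong_add; apply: h.
Qed.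

End Congruence.

(** Bridge to the valuation of the theorem: a zero witness gives equality, any other one a bound on
    valuations. *)
Lemma cong_padic_val (p m : nat) (x y : rat) :
  prime p -> cong p m x y -> eqmod_ppow p m x y.
Proof.
move=> pp [z hz ex]; rewrite {x}ex; have [->|z0] := eqVneq z 0.
  by left; rewrite mulr0 addr0.
right; have -> : y + p%:R ^+ m * z - y = p%:R ^+ m * z by ring.
move: hz; rewrite unfold_in => hz.
have p0 : (p%:R : rat) != 0 by rewrite pnatr_eq0 -lt0n prime_gt0.
set x := p%:R ^+ m * z.
have x0 : x != 0 by rewrite mulf_neq0 // expf_neq0.
(* Cross-multiplied, so that [logn] applies without computing the reduced form of p^m z. *)
have e : (numq x * denq z = (p ^ m)%N%:Z * numq z * denq x)%R.
  apply: (@intr_inj rat); rewrite !rmorphM /= !numqE /x -pmulrn natrX.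
  by ring.
have := congr1 (fun n => logn p `|n|%N) e; rewrite !abszM absz_nat.
rewrite !lognM ?muln_gt0 ?absz_gt0 ?numq_eq0 ?denq_neq0 ?x0 ?z0
  ?expn_gt0 ?(prime_gt0 pp) //.
rewrite pfactorK // (logn_coprime hz) /padic_val; lia.
Qed.

(** * Faulhaber's formula *)

(** Both sides are the multinomial coefficient n!/(j! l! (n-j-l)!). *)
Lemma mul_bin_swap n j l : (j + l <= n)%N ->
  ('C(n, j) * 'C(n - j, l) = 'C(n, l) * 'C(n - l, j))%N.
Proof.
move=> le; have f0 : (0 < j`! * l`! * (n - j - l)`!)%N by rewrite !muln_gt0 !fact_gt0.
apply/eqP; rewrite -(eqn_pmul2r f0); apply/eqP.
have e1 := @bin_fact n j ltac:(lia); have e2 := @bin_fact (n - j) l ltac:(lia).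
have e3 := @bin_fact n l ltac:(lia); have e4 := @bin_fact (n - l) j ltac:(lia).
have -> : ('C(n, j) * 'C(n - j, l) * (j`! * l`! * (n - j - l)`!) =
  'C(n, j) * (j`! * ('C(n - j, l) * (l`! * (n - j - l)`!))))%N by ring.
have -> : ('C(n, l) * 'C(n - l, j) * (j`! * l`! * (n - j - l)`!) =
  'C(n, l) * (l`! * ('C(n - l, j) * (j`! * (n - l - j)`!))))%N.
  by rewrite (_ : n - l - j = n - j - l)%N; [ring | lia].
by rewrite e2 e4 e1 e3.
Qed.

(** Induction on N. In the increment of the right side, the coefficient of N^l contains the
    Bernoulli recurrence sum of index n - l, which vanishes except for l = n. *)
Lemma faulhaber n N :
  n.+1%:R * \sum_(0 <= k < N) (k%:R : rat) ^+ n =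
  \sum_(j < n.+1) 'C(n.+1, j)%:R * bernoulli j * N%:R ^+ (n.+1 - j).
Proof.
elim: N => [|N IH].
  rewrite big_geq // mulr0 big1 // => j _.
  by rewrite expr0n (_ : n.+1 - j == 0 = false)%N ?mulr0 //; have := ltn_ord j; lia.
rewrite big_nat_recr //= mulrDr {}IH.
apply/eqP; rewrite addrC eq_sym -subr_eq; apply/eqP.
have diff m : N.+1%:R ^+ m - N%:R ^+ m = \sum_(l < m) 'C(m, l)%:R * N%:R ^+ l :> rat.
  rewrite -natr1 [N%:R + 1]addrC exprDn big_ord_recr /= subnn expr0 mul1r binn mulr1n.
  rewrite addrK; apply: eq_bigr => i _.
  by rewrite expr1n mul1r mulr_natl.
rewrite -sumrB.
have -> : \sum_(j < n.+1) ('C(n.+1, j)%:R * bernoulli j * N.+1%:R ^+ (n.+1 - j)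
     - 'C(n.+1, j)%:R * bernoulli j * N%:R ^+ (n.+1 - j)) =
   \sum_(j < n.+1) \sum_(l < n.+1 | (l < n.+1 - j)%N)
     'C(n.+1, l)%:R * N%:R ^+ l * ('C(n.+1 - l, j)%:R * bernoulli j).
  apply: eq_bigr => j _; rewrite -mulrBr diff mulr_sumr.
  rewrite (big_ord_widen n.+1 (fun l => 'C(n.+1, j)%:R * bernoulli j *
     ('C(n.+1 - j, l)%:R * N%:R ^+ l : rat))) ?leq_subr //.
  apply: eq_bigr => l lt.
  have := congr1 (fun n => n%:R : rat) (@mul_bin_swap n.+1 j l ltac:(lia)).
  rewrite !natrM => e.
  transitivity ('C(n.+1, j)%:R * 'C(n.+1 - j, l)%:R * bernoulli j * N%:R ^+ l).
    by ring.
  by rewrite e; ring.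
rewrite (exchange_big_dep xpredT) //= big_ord_recr /= big1 ?add0r => [|l _].
  rewrite (eq_bigl (fun j : 'I_n.+1 => (j < 1)%N)) => [|j]; last by lia.
  rewrite -(big_ord_widen n.+1 (fun j => 'C(n.+1, n)%:R * N%:R ^+ n *
     ('C(n.+1 - n, j)%:R * bernoulli j))) // -mulr_sumr subSnn bernoulli_rec.
  by rewrite mulr1 binSn.
rewrite (eq_bigl (fun j : 'I_n.+1 => (j < (n - l).+1)%N)) => [|j]; last first.
  by have := ltn_ord l; lia.
rewrite -(big_ord_widen n.+1 (fun j => 'C(n.+1, l)%:R * N%:R ^+ l *
     ('C(n.+1 - l, j)%:R * bernoulli j))); last by have := ltn_ord l; lia.
rewrite -mulr_sumr (_ : n.+1 - l = (n - l).+1)%N; last by have := ltn_ord l; lia.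
rewrite bernoulli_rec (_ : n - l == 0 = false)%N ?mulr0 //.
by have := ltn_ord l; lia.
Qed.

(** * Alternating binomial sums *)

(** At n = p - 1 this is T_j(1); a free n allows induction. *)
Definition alt_bin (n j : nat) : rat :=
  \sum_(1 <= k < n.+1) (-1) ^+ k * 'C(n, k)%:R * k%:R^-1 ^+ j.

Lemma alt_bin0 n : alt_bin n.+1 0 = - 1.
Proof.
have := exprDn (1 : rat) (- 1) n.+1; rewrite subrr expr0n /= => e.
apply/eqP; rewrite -addr_eq0 addrC; apply/eqP.
rewrite {}[RHS]e -(big_mkord xpredT (fun i =>
  1 ^+ (n.+1 - i) * (-1) ^+ i *+ 'C(n.+1, i) : rat)).
rewrite [RHS]big_ltn //= bin0 expr1n mul1r expr0; congr (_ + _).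
by apply: eq_bigr => k _; rewrite expr0 mulr1 expr1n mul1r mulr_natr.
Qed.

(** Pascal's rule, then the absorption (k+1) C(n+1,k+1) = (n+1) C(n,k), which trades one factor
    1/(k+1) for 1/(n+1). *)
Lemma alt_bin_rec n j :
  alt_bin n.+1 j.+1 = alt_bin n j.+1 + n.+1%:R^-1 * alt_bin n.+1 j.
Proof.
have -> : alt_bin n j.+1 =
    \sum_(1 <= k < n.+2) (-1) ^+ k * 'C(n, k)%:R * k%:R^-1 ^+ j.+1.
  by rewrite big_nat_recr //= bin_small // mulr0 mul0r addr0.
rewrite /alt_bin mulr_sumr -big_split /=; apply: eq_big_nat => -[//|k] _.
have n0 : (n.+1%:R : rat) != 0 by rewrite pnatr_eq0.
have k0 : (k.+1%:R : rat) != 0 by rewrite pnatr_eq0.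
have := congr1 (fun n => n%:R : rat) (mul_bin_diag n.+1 k).
rewrite !natrM /= binS natrD [_^-1 ^+ j.+1]exprS; move: n0 k0.
move: (n.+1%:R : rat) (k.+1%:R : rat) ((-1) ^+ k.+1 : rat) => x y s x0 y0.
move: ('C(n, k.+1)%:R : rat) ('C(n, k)%:R : rat) (y^-1 ^+ j) => u v w e.
have -> : u = x * v / y - v by rewrite e; field.
by field; rewrite x0 y0.
Qed.

Lemma alt_bin1 n : alt_bin n 1 = - \sum_(1 <= k < n.+1) k%:R^-1.
Proof.
elim: n => [|n IH]; first by rewrite /alt_bin !big_geq ?oppr0.
by rewrite alt_bin_rec IH alt_bin0 [in RHS]big_nat_recr //= opprD mulrN1.
Qed.

Lemma alt_bin2 n : alt_bin n 2 =
  - ((\sum_(1 <= k < n.+1) k%:R^-1) ^+ 2 + \sum_(1 <= k < n.+1) k%:R^-1 ^+ 2) / 2.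
Proof.
elim: n => [|n IH]; first by rewrite /alt_bin !big_geq // expr0n addr0 oppr0 mul0r.
rewrite alt_bin_rec alt_bin1 IH ![\sum_(1 <= k < n.+2) _]big_nat_recr //=.
by move: (n.+1%:R^-1) => h; field.
Qed.

Section Prime.

Variable p : nat.
Hypotheses (hp : prime p) (hp5 : (5 < p)%N).

(** * p-adic expansion of integer powers *)

Lemma coprime_lt d : (0 < d < p)%N -> coprime p d.
Proof.
move=> /andP[d0 dp]; rewrite prime_coprime //; apply/negP => /(dvdn_leq d0).
by rewrite leqNgt dp.
Qed.

Lemma pint_inv_lt d : (0 < d < p)%N -> (d%:R^-1 : rat) \in pint p.
Proof. by move=> h; apply: pint_invn; [case/andP: h | exact: coprime_lt]. Qed.

Lemma pint_inv2 : (2%:R^-1 : rat) \in pint p.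
Proof. by apply: pint_inv_lt; lia. Qed.

Lemma pint_inv3 : (3%:R^-1 : rat) \in pint p.
Proof. by apply: pint_inv_lt; lia. Qed.

Lemma pint_inv5 : (5%:R^-1 : rat) \in pint p.
Proof. by apply: pint_inv_lt; lia. Qed.

Lemma p_neq0 : (p%:R : rat) != 0.
Proof. by rewrite pnatr_eq0 -lt0n prime_gt0. Qed.

(** For x = n/d the numerator d - p n of 1 - p x is prime to p, because d is. *)
Lemma one_sub_unit x : x \in pint p ->
  1 - p%:R * x != 0 /\ (1 - p%:R * x)^-1 \in pint p.
Proof.
rewrite unfold_in => cx; have [d ed] : exists d : nat, denq x = d.
  by exists `|denq x|%N; rewrite absz_denq.
have d0 : (0 < d)%N by have := denq_gt0 x; rewrite ed.
move: cx; rewrite ed absz_nat => cx.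
have dr0 : (d%:R : rat) != 0 by rewrite pnatr_eq0 -lt0n.
have cn : coprime p `|(d%:Z - p%:Z * numq x)%R|%N.
  rewrite prime_coprime //; apply/negP => h.
  have h' : (d%:Z - p%:Z * numq x \in dvdz p)%Z by rewrite dvdzE.
  have : (d%:Z \in dvdz p)%Z.
    by rewrite -(subrK (p%:Z * numq x) d%:Z) rpredD // dvdz_mulr.
  by apply/negP; rewrite dvdzE /= -prime_coprime.
have n0 : d%:Z - p%:Z * numq x != 0.
  apply/eqP => h; move: cn; rewrite h /= /coprime gcdn0 => /eqP p1.
  by have := hp; rewrite p1.
have E : 1 - p%:R * x = (d%:Z - p%:Z * numq x)%:~R / d%:R.
  rewrite rmorphB rmorphM /= numqE ed -!pmulrn; field; exact: dr0.
rewrite E mulf_neq0 ?invr_eq0 ?intr_eq0 //; split=> //.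
rewrite invfM invrK; apply: rpredM; last exact: rpred_nat.
exact: pint_invz.
Qed.

(* The binomial series of (1 - y)^(-e), truncated at y^5. *)
Definition neg_binom (e y : rat) : rat :=
  1 + e * y + e * (e + 1) / 2 * y ^+ 2 + e * (e + 1) * (e + 2) / 6 * y ^+ 3
  + e * (e + 1) * (e + 2) * (e + 3) / 24 * y ^+ 4
  + e * (e + 1) * (e + 2) * (e + 3) * (e + 4) / 120 * y ^+ 5.

(** Induction on e in both directions from 0. Multiplying the truncated series at f + 1 by 1 - y
    gives the one at f up to a single term in y^6, whose coefficient is p-integral because 120 has
    only the prime factors 2, 3, 5. *)
Lemma neg_binomP (e : int) x : x \in pint p ->
  cong p 6 ((1 - p%:R * x) ^ (- e)) (neg_binom e%:~R (p%:R * x)).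
Proof.
move=> hx; have [u0 hu] := one_sub_unit x hx; set y := p%:R * x in u0 hu *.
have hy : y \in pint p by rewrite /y; pint.
pose c (e : rat) := e * (e + 1) * (e + 2) * (e + 3) * (e + 4) / 120.
have step (f : rat) : neg_binom f y =
    neg_binom (f + 1) y * (1 - y) + c (f + 1) * y ^+ 6.
  by rewrite /neg_binom /c; field.
have hc (f : int) : c f%:~R \in pint p.
  rewrite /c (_ : 120 = 2 * 2 * 2 * 3 * 5) ?invfM; last by ring.
  have [] := (pint_inv2, pint_inv3, pint_inv5); move=> [h2 h3] h5; pint.
have y6 : y ^+ 6 = p%:R ^+ 6 * x ^+ 6 by rewrite /y exprMn.
elim: e => [|n [z hz IH]|n [z hz IH]].
- rewrite oppr0 expr0z /neg_binom !mul0r !addr0; exact: cong_refl.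
- exists ((z + c n.+1%:~R * x ^+ 6) * (1 - y)^-1); first by have hcn := hc n.+1; pint.
  have -> : (1 - y) ^ (- n.+1%:Z) = (1 - y) ^ (- n%:Z) * (1 - y)^-1.
    by rewrite -exprN1 -expfzDr //; congr (_ ^ _); lia.
  rewrite IH (step n%:~R) y6.
  have -> : n.+1%:~R = n%:~R + 1 :> rat by rewrite -!pmulrn -natr1.
  by field.
- exists (z * (1 - y) - c (- n%:~R) * x ^+ 6).
    by have := hc (- n%:Z); rewrite rmorphN /= => hcn; pint.
  have -> : (1 - y) ^ (- - n.+1%:Z) = (1 - y) ^ (- - n%:Z) * (1 - y).
    by rewrite -[X in _ * X]expr1z -expfzDr //; congr (_ ^ _); lia.
  have e1 : (- n.+1%:Z)%:~R = (- n%:~R) - 1 :> rat.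
    by rewrite rmorphN /= -!pmulrn -natr1; ring.
  rewrite IH e1 (step (- n%:~R - 1)) subrK rmorphN /= y6.
  by ring.
Qed.

(** * Sums of powers of the signed binomials *)

(** [sbin], [psum] and [tsum] are u_k, P(n) and T_j(a). *)
Definition sbin (k : nat) : rat := (-1) ^+ k * 'C(p.-1, k)%:R.

Definition psum (n : int) : rat := \sum_(1 <= k < p) (k%:R : rat) ^ n.

Definition tsum (a : int) (j : nat) : rat :=
  \sum_(1 <= k < p) sbin k ^ a * (k%:R^-1) ^+ j.

Lemma nat_neq0 k : (0 < k)%N -> (k%:R : rat) != 0.
Proof. by rewrite pnatr_eq0 lt0n. Qed.

Lemma sbin0 : sbin 0 = 1.
Proof. by rewrite /sbin bin0 mulr1. Qed.

Lemma sbinS k : (k.+1 < p)%N -> sbin k.+1 = sbin k * (1 - p%:R * k.+1%:R^-1).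
Proof.
move=> lt; have k0 := nat_neq0 k.+1 isT.
have := congr1 (fun n => n%:R : rat) (mul_bin_left p.-1 k).
rewrite !natrM natrB; last by lia.
have -> : (p.-1%:R : rat) = p%:R - 1 by rewrite -subn1 natrB //; lia.
rewrite /sbin exprS => e; apply: (mulfI k0).
have -> : k.+1%:R * (-1 * (-1) ^+ k * 'C(p.-1, k.+1)%:R) =
  - (-1) ^+ k * (k.+1%:R * 'C(p.-1, k.+1)%:R) :> rat by ring.
rewrite e -natr1 in k0 *; field; exact: k0.
Qed.

(** As p - 1 is even, the sign is kept under the symmetry of the binomials. *)
Lemma sbin_rev k : (k < p)%N -> sbin (p.-1 - k) = sbin k.
Proof.
move=> lt; rewrite /sbin bin_sub; last by lia.
congr (_ * _); rewrite -signr_odd oddB; last by lia.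
have -> : odd p.-1 = false.
  by have [p2|op] := even_prime hp; [move: hp5; rewrite p2 | lia].
by rewrite addFb signr_odd.
Qed.

Lemma sbin_last : sbin p.-1 = 1.
Proof. by rewrite -(subn0 p.-1) sbin_rev ?sbin0 //; lia. Qed.

Lemma sbin_unit k : (k < p)%N ->
  [/\ sbin k != 0, sbin k \in pint p & (sbin k)^-1 \in pint p].
Proof.
elim: k => [|k IH] lt; first by rewrite sbin0 invr1 oner_neq0 rpred1.
have [n0 h hi] := IH (ltnW lt).
have hk : (k.+1%:R^-1 : rat) \in pint p by apply: pint_inv_lt.
have [n1 h1] := one_sub_unit _ hk.
rewrite sbinS // invfM mulf_neq0 //; split=> //; pint.
Qed.

Lemma sbin_cong1 k : (k < p)%N -> exists2 x, x \in pint p & sbin k = 1 - p%:R * x.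
Proof.
elim: k => [|k IH] lt; first by exists 0; rewrite ?rpred0 // mulr0 subr0 sbin0.
have [x hx e] := IH (ltnW lt).
have [_ h _] := sbin_unit k (ltnW lt).
have hk : (k.+1%:R^-1 : rat) \in pint p by apply: pint_inv_lt.
exists (x + sbin k * k.+1%:R^-1); first by pint.
rewrite sbinS // {1}e mulrDr mulr1 {1}e; ring.
Qed.

Lemma sbinX_unit a k : (k < p)%N -> sbin k ^ a \in pint p.
Proof. by move=> lt; have [_ h hi] := sbin_unit k lt; apply: pint_expz. Qed.

Lemma tsum_int a j : tsum a j \in pint p.
Proof.
rewrite /tsum big_nat; apply: rpred_sum => k /andP[k1 kp].
apply: rpredM; first exact: sbinX_unit.
by apply/rpredX/pint_inv_lt; rewrite ?k1.
Qed.

Lemma tsum0 j : tsum 0 j = psum (- j%:Z).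
Proof.
by apply: eq_bigr => k _; rewrite expr0z mul1r -exprnN exprVn.
Qed.

Lemma sbinX_prev a k : (0 < k < p)%N ->
  sbin k.-1 ^ a = sbin k ^ a * (1 - p%:R * k%:R^-1) ^ (- a).
Proof.
case: k => // k /andP[_ lt] /=.
have hk : (k.+1%:R^-1 : rat) \in pint p by apply: pint_inv_lt.
have [n1 _] := one_sub_unit _ hk.
by rewrite sbinS // [in RHS]expfzMl -[RHS]mulrA -expfzDr // subrr expr0z mulr1.
Qed.

(** Serves twice: with weights u_k^a / k^j for the reflection, and k u_k^a for the Abel
    summation. *)
Lemma sum_neg_binom (w : nat -> rat) (a : int) (e : rat := a%:~R) :
  (forall k, (0 < k < p)%N -> w k \in pint p) ->
  cong p 6 (\sum_(1 <= k < p) w k * (1 - p%:R * k%:R^-1) ^ (- a))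
   (\sum_(1 <= k < p) w k + e * p%:R * (\sum_(1 <= k < p) w k * k%:R^-1)
    + e * (e + 1) / 2 * p%:R ^+ 2 * (\sum_(1 <= k < p) w k * k%:R^-1 ^+ 2)
    + e * (e + 1) * (e + 2) / 6 * p%:R ^+ 3
      * (\sum_(1 <= k < p) w k * k%:R^-1 ^+ 3)
    + e * (e + 1) * (e + 2) * (e + 3) / 24 * p%:R ^+ 4
      * (\sum_(1 <= k < p) w k * k%:R^-1 ^+ 4)
    + e * (e + 1) * (e + 2) * (e + 3) * (e + 4) / 120 * p%:R ^+ 5
      * (\sum_(1 <= k < p) w k * k%:R^-1 ^+ 5)).
Proof.
move=> hw; rewrite 5!mulr_sumr -5!big_split /=.
rewrite big_nat [X in cong _ _ _ X]big_nat; apply: cong_sum => k kp.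
set r := (X in cong _ _ _ X).
have -> : r = w k * neg_binom e (p%:R * k%:R^-1).
  by rewrite /r /neg_binom; move: (k%:R^-1) => v; field.
by apply: cong_mull; [exact: hw | apply/neg_binomP/pint_inv_lt].
Qed.

(* Reflection k -> p - k, under which sbin (p - k) = sbin (k - 1). *)
Lemma tsum_rev a j (e := (a + j%:Z)%:~R : rat) :
  cong p 6 (tsum a j) ((-1) ^+ j *
   (tsum a j + e * p%:R * tsum a j.+1 + e * (e + 1) / 2 * p%:R ^+ 2 * tsum a j.+2
    + e * (e + 1) * (e + 2) / 6 * p%:R ^+ 3 * tsum a j.+3
    + e * (e + 1) * (e + 2) * (e + 3) / 24 * p%:R ^+ 4 * tsum a j.+4
    + e * (e + 1) * (e + 2) * (e + 3) * (e + 4) / 120 * p%:R ^+ 5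
      * tsum a j.+4.+1)).
Proof.
pose w k := sbin k ^ a * (k%:R^-1) ^+ j.
have rev : tsum a j = (-1) ^+ j *
    \sum_(1 <= k < p) w k * (1 - p%:R * k%:R^-1) ^ (- (a + j%:Z)).
  rewrite mulr_sumr /tsum big_nat_rev; apply: eq_big_nat => k /andP[k1 kp].
  have kp' : (0 < k < p)%N by rewrite k1.
  have hk : (k%:R^-1 : rat) \in pint p by apply: pint_inv_lt.
  have [n1 _] := one_sub_unit _ hk.
  have k0 := nat_neq0 k k1.
  (* The reversed index is p - k. Here u_(p-k)^a = u_(k-1)^a = u_k^a (1 - p/k)^(-a), while (p -
     k)^(-j) brings (-1)^j (1 - p/k)^(-j); this explains the exponent -(a + j). *)
  have -> : (1 + p - k.+1 = p.-1 - k.-1)%N by lia.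
  rewrite sbin_rev; last by lia.
  rewrite sbinX_prev // opprD expfzDr // (_ : _ - _ = p - k)%N; last by lia.
  have -> : ((p - k)%N%:R : rat) = - k%:R * (1 - p%:R * k%:R^-1).
    by rewrite natrB ?(ltnW kp) //; field.
  rewrite invfM invrN -[- k%:R^-1]mulN1r !exprMn /w !exprVn -!exprnN; ring.
rewrite {1}rev; apply: cong_mull; first by pint.
have hw k : (0 < k < p)%N -> w k \in pint p.
  move=> kp; apply: rpredM; first by apply: sbinX_unit; case/andP: kp.
  by apply/rpredX/pint_inv_lt.
have := sum_neg_binom w (a + j%:Z) hw.
have E i : \sum_(1 <= k < p) w k * k%:R^-1 ^+ i = tsum a (j + i).
  by apply: eq_bigr => k _; rewrite /w exprD mulrA.
have E0 := E 0%N; have E1 := E 1%N; rewrite /= addn0 in E0.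
rewrite (eq_bigr w) in E0 => [|k _]; last by rewrite expr0 mulr1.
by rewrite E0 E1 !E !addnS addn0.
Qed.

Definition ssum (a : int) : rat := \sum_(0 <= k < p) sbin k ^ a.

(* Abel summation of 1 against sbin k ^ a. *)
Lemma ssum_cong a (e := a%:~R : rat) :
  cong p 6 (ssum a) (p%:R + e * p%:R * (ssum a - 1)
    + e * (e + 1) / 2 * p%:R ^+ 2 * tsum a 1
    + e * (e + 1) * (e + 2) / 6 * p%:R ^+ 3 * tsum a 2
    + e * (e + 1) * (e + 2) * (e + 3) / 24 * p%:R ^+ 4 * tsum a 3
    + e * (e + 1) * (e + 2) * (e + 3) * (e + 4) / 120 * p%:R ^+ 5 * tsum a 4).
Proof.
have abel N : \sum_(0 <= k < N.+1) sbin k ^ a = N.+1%:R * sbin N ^ a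
   - \sum_(1 <= k < N.+1) k%:R * (sbin k ^ a - sbin k.-1 ^ a).
  elim: N => [|N IH]; first by rewrite big_nat1 big_geq // mul1r subr0.
  rewrite big_nat_recr //= IH [in RHS]big_nat_recr //= -!natr1; ring.
have p1 : p = p.-1.+1 by lia.
have d0 : ssum a = 1 + tsum a 0.
  rewrite /ssum big_ltn ?prime_gt0 // sbin0 exp1rz; congr (_ + _).
  by apply: eq_bigr => k _; rewrite expr0 mulr1.
(* The Abel factor k lowers each index by one: the series starts with T_0 = S(a) - 1 and ends with
   T_4, its constant term cancelling. *)
pose w k := k%:R * sbin k ^ a.
have hw k : (0 < k < p)%N -> w k \in pint p.
  by case/andP=> _ kp; apply: rpredM; [exact: rpred_nat | exact: sbinX_unit].
have E i : \sum_(1 <= k < p) w k * k%:R^-1 ^+ i.+1 = tsum a i.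
  apply: eq_big_nat => k /andP[k1 _]; rewrite /w exprS; move: (nat_neq0 k k1) => k0.
  by field.
have Sa : ssum a = p%:R
    - (\sum_(1 <= k < p) w k - \sum_(1 <= k < p) w k * (1 - p%:R * k%:R^-1) ^ (- a)).
  rewrite {1}/ssum p1 abel -p1 sbin_last exp1rz mulr1 -sumrB; congr (_ - _).
  apply: eq_big_nat => k kp; rewrite sbinX_prev //; rewrite /w; ring.
have E1 := E 0%N.
have [z hz ez] := sum_neg_binom w a hw.
rewrite {1}Sa ez E1 !E d0; exists z => //.
rewrite -/e; move: (tsum a 0) (tsum a 1) (tsum a 2) (tsum a 3) (tsum a 4).
move: (2^-1) (6^-1) (24^-1) (120^-1); clearbody e => *; ring.
Qed.

(** * Power sums with integer exponents *)

Lemma neg_binom3 (a : int) x (e : rat := a%:~R) : x \in pint p ->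
  cong p 3 ((1 - p%:R * x) ^ (- a))
    (1 + e * p%:R * x + e * (e + 1) / 2 * p%:R ^+ 2 * x ^+ 2).
Proof.
move=> hx; apply: (cong_trans _ _ (neg_binom a%:~R (p%:R * x))).
  by apply: (@cong_weaken _ 6) => //; apply: neg_binomP.
have h2 := pint_inv2; have h3 := pint_inv3.
have h5 := pint_inv5; have he : e \in pint p by exact: rpred_int.
exists (e * (e + 1) * (e + 2) * 2^-1 * 3^-1 * x ^+ 3
   + e * (e + 1) * (e + 2) * (e + 3) * 2^-1 ^+ 3 * 3^-1 * p%:R * x ^+ 4
   + e * (e + 1) * (e + 2) * (e + 3) * (e + 4) * 2^-1 ^+ 3 * 3^-1 * 5^-1
     * p%:R ^+ 2 * x ^+ 5); first by pint.
by rewrite /neg_binom -/e; field.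
Qed.

Lemma p_half : p = (p./2).*2.+1.
Proof.
have [p2|op] := even_prime hp; first by move: hp5; rewrite p2.
by rewrite -{1}(odd_double_half p) op.
Qed.

(** Modulo p^3, n p times the summand is (2k)^n - (2k - p)^n, expanded to second order in p. *)
Definition vsum (n : int) : rat := \sum_((p./2).+1 <= k < p)
  ((2 * k)%:R ^ (n - 1) - (n%:~R - 1) / 2 * p%:R * (2 * k)%:R ^ (n - 2)).

Lemma pint_inv_2k k : (0 < k < p)%N -> ((2 * k)%:R^-1 : rat) \in pint p.
Proof.
move=> kp; rewrite natrM invfM; apply: rpredM; first exact: pint_inv2.
exact: pint_inv_lt.
Qed.

(* k |-> 2k mod p permutes the nonzero residues. *)
Lemma psum_voronoi (n : int) :
  cong p 3 ((2 ^ n - 1) * psum n) (n%:~R * p%:R * vsum n).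
Proof.
have split N (f : nat -> rat) : \sum_(1 <= k < N.*2.+1) f k =
    \sum_(1 <= k < N.+1) f (2 * k)%N + \sum_(0 <= i < N) f (2 * i).+1.
  elim: N => [|N IH]; first by rewrite !big_geq ?addr0.
  rewrite doubleS big_nat_recr // big_nat_recr //= IH.
  rewrite [in RHS]big_nat_recr // [X in _ = _ + X]big_nat_recr //= -mul2n.
  by rewrite (_ : (2 * N).+2 = 2 * N.+1)%N; [ring | lia].
(* The odd numbers below p are the 2k - p with p/2 < k < p, where k = i + (p+1)/2. *)
have shift : \sum_(0 <= i < p./2) ((2 * i).+1%:R : rat) ^ n =
    \sum_((p./2).+1 <= k < p) (2 * k)%:R ^ n * (1 - p%:R * (2 * k)%:R^-1) ^ (- (- n)).
  rewrite -{1}[(p./2).+1]add0n big_addn (_ : p - (p./2).+1 = p./2)%N; last first.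
    by have := p_half; lia.
  apply: eq_big_nat => i /andP[_ ih]; rewrite opprK -expfzMl; congr (_ ^ _).
  have k0 : ((2 * (i + (p./2).+1))%:R : rat) != 0 by apply: nat_neq0; lia.
  have -> : (2 * i).+1 = (2 * (i + (p./2).+1) - p)%N by have := p_half; lia.
  rewrite natrB; last by have := p_half; lia.
  by move: k0; move: (_%:R : rat) => x k0; field.
(* In 2^n P(n) - P(n), the terms (2k)^n with k < p/2 cancel the even terms of P(n). *)
have E : (2 ^ n - 1) * psum n = \sum_((p./2).+1 <= k < p)
   ((2 * k)%:R ^ n - (2 * k)%:R ^ n * (1 - p%:R * (2 * k)%:R^-1) ^ (- (- n))).
  rewrite sumrB -shift mulrBl mul1r {2}/psum [in X in _ - X]p_half split.
  rewrite /psum mulr_sumr (@big_cat_nat _ _ _ (p./2).+1) //=; last first.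
    by have := p_half; lia.
  have -> : \sum_(1 <= i < (p./2).+1) 2 ^ n * i%:R ^ n =
      \sum_(1 <= k < (p./2).+1) ((2 * k)%N%:R : rat) ^ n.
    by apply: eq_bigr => i _; rewrite natrM expfzMl.
  have -> : \sum_((p./2).+1 <= i < p) 2 ^ n * i%:R ^ n =
      \sum_((p./2).+1 <= k < p) ((2 * k)%N%:R : rat) ^ n.
    by apply: eq_bigr => i _; rewrite natrM expfzMl.
  ring.
rewrite E /vsum mulr_sumr big_nat [X in cong _ _ _ X]big_nat.
apply: cong_sum => k /andP[kh kp].
have k1 : (0 < k < p)%N by lia.
have hk := pint_inv_2k k k1; have k0 : ((2 * k)%:R : rat) != 0 by apply: nat_neq0; lia.
have [z hz ->] := neg_binom3 (- n) _ hk.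
exists (- ((2 * k)%:R ^ n * z)).
  by rewrite rpredN; apply: rpredM => //; apply: pint_expz => //; apply: rpred_nat.
rewrite !expfzDr // rmorphN /=; set x := (2 * k)%:R in k0 *; clearbody x.
have -> : x ^ (- 2) = x^-1 ^+ 2 by rewrite exprVn -exprnN.
by rewrite exprN1; field.
Qed.

Lemma fermat k : coprime p k -> cong p 1 (k%:R ^+ p.-1) 1.
Proof.
move=> cpk; have k0 : (0 < k)%N.
  by rewrite lt0n; apply/eqP => e; move: cpk hp; rewrite e /coprime gcdn0 => /eqP->.
have : (k ^ p.-1 = 1 %[mod p])%N.
  by rewrite -(totient_prime hp) Euler_exp_totient // coprime_sym.
move/eqP; rewrite eqn_mod_dvd ?expn_gt0 ?k0 // => /dvdnP[q e].
exists q%:R; first exact: rpred_nat.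
rewrite -natrX -(subnK (m := 1) (n := k ^ p.-1)) ?expn_gt0 ?k0 // e.
by rewrite natrD natrM; ring.
Qed.

Lemma coprime_2k k : (0 < k < p)%N -> coprime p (2 * k).
Proof. by move=> kp; rewrite coprimeMr !coprime_lt //; lia. Qed.

Lemma vsum_int n : vsum n \in pint p.
Proof.
have h2 := pint_inv2; have hn : n%:~R \in pint p := rpred_int _ n.
rewrite /vsum big_nat; apply: rpred_sum => k /andP[kh kp].
have hk : ((2 * k)%:R^-1 : rat) \in pint p by apply: pint_inv_2k => //; lia.
have hx i : ((2 * k)%:R : rat) ^ i \in pint p.
  by apply: pint_expz => //; apply: rpred_nat.
have h3 := hx (n - 1); have h4 := hx (n - 2); pint.
Qed.

Lemma psum_periodic n : cong p 1 (psum (n + p.-1%:Z)) (psum n).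
Proof.
rewrite /psum big_nat [X in cong _ _ _ X]big_nat; apply: cong_sum => k kp.
rewrite expfzDr; last by apply: nat_neq0; case/andP: kp.
rewrite -[X in cong _ _ _ X]mulr1; apply: cong_mull.
  by apply: pint_expz; [exact: rpred_nat | exact: pint_inv_lt].
by rewrite -exprnP; apply: fermat => //; apply: coprime_lt.
Qed.

(** When 2^n - 1 is a unit, it can be cancelled in [psum_voronoi], whose right side is a multiple of
    p. *)
Lemma psum_cong0 n c : (2 ^ n - 1) * c = 1 -> c \in pint p -> cong p 1 (psum n) 0.
Proof.
move=> e hc; have [z hz ez] := psum_voronoi n.
have h1 := vsum_int n; have hn : n%:~R \in pint p := rpred_int _ n.
exists (c * (n%:~R * vsum n + p%:R ^+ 2 * z)); first by pint.
rewrite -[LHS]mul1r -[X in X * _]e mulrAC ez; ring.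
Qed.

Lemma psum_neg2 : cong p 1 (psum (- 2)) 0.
Proof.
apply: (psum_cong0 _ (- 4 * 3^-1)); first by rewrite -exprnN; field.
by have := pint_inv3 => h3; rewrite mulNr; pint.
Qed.

Lemma psum_neg4 : cong p 1 (psum (- 4)) 0.
Proof.
apply: (psum_cong0 _ (- 16 * (3^-1 * 5^-1))); first by rewrite -exprnN; field.
by have h3 := pint_inv3; have h5 := pint_inv5; rewrite mulNr; pint.
Qed.

(* The exponents -2, p - 3, 2p - 4, ... *)
Definition kexp (j : nat) : int := - 2 + (j * p.-1)%N%:Z.

Lemma p1E : (p.-1%:R : rat) = p%:R - 1.
Proof. by rewrite -subn1 natrB //; lia. Qed.

Lemma kexpE j : (kexp j)%:~R = - 2 + j%:R * (p%:R - 1) :> rat.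
Proof. by rewrite /kexp rmorphD rmorphN /= -!pmulrn natrM p1E. Qed.

Lemma psum_kexp j : cong p 1 (psum (kexp j)) 0.
Proof.
elim: j => [|j IH]; first by rewrite /kexp mul0n addr0; apply: psum_neg2.
apply: cong_trans IH; have -> : kexp j.+1 = kexp j + p.-1%:Z by rewrite /kexp; lia.
exact: psum_periodic.
Qed.

(** Isolates the Fermat factor x^(p-1) = 1 + p z, the only one that depends on j. *)
Lemma expz_kexp (x : rat) j (m : int) : x != 0 ->
  x ^ (kexp j + m) = x ^ (- 2 + m) * (x ^+ p.-1) ^+ j.
Proof.
move=> x0; rewrite (_ : kexp j + m = (- 2 + m) + (p.-1 * j)%N%:Z).
  by rewrite expfzDr // -exprnP exprM.
by rewrite /kexp; lia.
Qed.

Lemma vsum_kexp_cong : cong p 1 (vsum (kexp 2)) (vsum (kexp 1)).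
Proof.
rewrite /vsum big_nat [X in cong _ _ _ X]big_nat; apply: cong_sum => k /andP[kh kp].
have k1 : (0 < k < p)%N by lia.
have k0 : ((2 * k)%:R : rat) != 0 by apply: nat_neq0; lia.
have [z hz ez] := fermat _ (coprime_2k k k1).
have hk := pint_inv_2k k k1.
have hx i : ((2 * k)%:R : rat) ^ i \in pint p.
  by apply: pint_expz => //; apply: rpred_nat.
have h2 := pint_inv2.
rewrite !expz_kexp // ez !kexpE; have := hx (- 2 + -1); have := hx (- 2 - 2).
move: (_ ^ (- 2 + -1)) (_ ^ (- 2 - 2)) => a b hb ha.
exists (a * (1 + p%:R * z) * z - 2^-1 * b * (1 + p%:R * z) *
  ((2 * p%:R - 5) * (1 + p%:R * z) - (p%:R - 4))); first by pint.
by field.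
Qed.

Lemma cong_sum0 m a b (F : nat -> rat) :
  (forall k, (a <= k < b)%N -> cong p m (F k) 0) ->
  cong p m (\sum_(a <= k < b) F k) 0.
Proof.
move=> hF; rewrite big_nat; elim/big_rec: _ => [|i x Pi IH]; first exact: cong_refl.
by rewrite -[X in cong _ _ _ X]addr0; apply: cong_add => //; apply: hF.
Qed.

(** With (2k)^(p-1) = 1 + p z, the first terms form a geometric progression in j, with second
    difference a multiple of (p z)^2. The second terms have a factor p already; modulo p they are
    affine in j, which gives another. *)
Lemma vsum_second_difference :
  cong p 2 (vsum (kexp 0) - 2 * vsum (kexp 1) + vsum (kexp 2)) 0.
Proof.
rewrite /vsum mulr_sumr -sumrB -big_split /=; apply: cong_sum0 => k /andP[kh kp].
have k1 : (0 < k < p)%N by lia.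
have k0 : ((2 * k)%:R : rat) != 0 by apply: nat_neq0; lia.
have [z hz ez] := fermat _ (coprime_2k k k1).
have hk := pint_inv_2k k k1.
have hx i : ((2 * k)%:R : rat) ^ i \in pint p.
  by apply: pint_expz => //; apply: rpred_nat.
have h2 := pint_inv2.
rewrite !expz_kexp // ez !kexpE; have := hx (- 2 + -1); have := hx (- 2 - 2).
move: (_ ^ (- 2 + -1)) (_ ^ (- 2 - 2)) => a b hb ha.
exists (a * z ^+ 2 - 2^-1 * b * z *
  (2 * (4 - p%:R) + (2 * p%:R - 5) * (2 + p%:R * z))); first by pint.
by field.
Qed.

Lemma pint_kexp j : (j < 3)%N ->
  (kexp j)%:~R != 0 :> rat /\ ((kexp j)%:~R^-1 : rat) \in pint p.
Proof.
move=> lt; have cop : coprime p `|kexp j|%N.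
  case: j lt => [|[|[|//]]] _.
  - rewrite (_ : `|kexp 0|%N = 2)%N //; apply: coprime_lt => //; lia.
  - rewrite (_ : `|kexp 1|%N = p - 3)%N; last by rewrite /kexp; lia.
    by apply: coprime_lt => //; lia.
  - rewrite (_ : `|kexp 2|%N = 2 * (p - 2))%N; last by rewrite /kexp; lia.
    by apply: coprime_2k; lia.
have n0 : kexp j != 0 by move: j lt {cop} => [|[|[|//]]] _; rewrite /kexp; lia.
by rewrite intr_eq0; split=> //; apply: pint_invz.
Qed.

(* The second difference of P(n)/n along n = -2, p - 3, 2p - 4, which carries the
   Kummer-type congruence for divided Bernoulli numbers back to P(-2). *)
Lemma psum_second_difference (r := fun j => psum (kexp j) / (kexp j)%:~R) :
  cong p 3 (r 0%N - 2 * r 1%N + r 2%N) 0.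
Proof.
have h2 := pint_inv2; have h3 := pint_inv3.
have rE j : (j < 3)%N -> exists2 w, w \in pint p &
    (2 ^ kexp j - 1) * r j = p%:R * vsum (kexp j) + p%:R ^+ 3 * w.
  move=> lt; have [n0 hn] := pint_kexp j lt.
  have [z hz ez] := psum_voronoi (kexp j).
  exists ((kexp j)%:~R^-1 * z); first by pint.
  by rewrite /r mulrA ez; field.
have r0 j : (j < 3)%N -> exists2 w, w \in pint p & r j = p%:R * w.
  move=> lt; have [n0 hn] := pint_kexp j lt.
  have [z hz ez] := psum_kexp j.
  by exists (z / (kexp j)%:~R); rewrite /r ?ez; [pint | ring].
have [q hq eq] := fermat 2 (coprime_lt 2 ltac:(lia)).
have c j : (2 : rat) ^ kexp j = 4^-1 * (1 + p%:R * q) ^+ j.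
  by rewrite -[kexp j]addr0 expz_kexp // eq addr0 -exprnN.
have [w0 hw0 e0] := rE 0%N isT; have [w1 hw1 e1] := rE 1%N isT.
have [w2 hw2 e2] := rE 2%N isT.
have [s1 hs1 f1] := r0 1%N isT; have [s2 hs2 f2] := r0 2%N isT.
have [t ht et] := vsum_kexp_cong; have [v hv ev] := vsum_second_difference.
rewrite !c {rE r0 c} in e0 e1 e2.
move: (r 0%N) (r 1%N) (r 2%N) (vsum (kexp 0)) (vsum (kexp 1)) (vsum (kexp 2))
  e0 e1 e2 f1 f2 et ev => R0 R1 R2 Q0 Q1 Q2 e0 e1 e2 f1 f2 et ev.
(* The constant -4/3 is the inverse of 2^(-2) - 1. Each multiplier 2^n - 1 differs from 2^(-2) - 1
   by a multiple of p, and R1, R2 are divisible by p; so R2 - R1 is divisible by p^2. *)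
pose s := (- (2 ^+ 2 * 3^-1)) * (t + p%:R * (w2 - w1)
   - 2^-1 ^+ 2 * q * ((2 + p%:R * q) * s2 - s1)).
have hs : s \in pint p by rewrite /s mulNr; pint.
have es : R2 - R1 = p%:R ^+ 2 * s.
  have -> : R2 - R1 = (- (2 ^+ 2 * 3^-1)) *
    ((4^-1 * (1 + p%:R * q) ^+ 2 - 1) * R2 - (4^-1 * (1 + p%:R * q) ^+ 1 - 1) * R1
     - 4^-1 * p%:R * q * ((2 + p%:R * q) * R2 - R1)) by field.
  by rewrite e1 e2 f1 f2 et /s; field.
(* Replacing the three multipliers by 2^(-2) - 1 costs p q (p q R2 + 2 (R2 - R1)) / 4, a multiple of
   p^3 by the previous step. *)
exists ((- (2 ^+ 2 * 3^-1)) * (v + w0 - 2 * w1 + w2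
   - 2^-1 ^+ 2 * q * (q * s2 + 2 * s))); first by rewrite mulNr; pint.
have -> : R0 - 2 * R1 + R2 = (- (2 ^+ 2 * 3^-1)) *
  ((4^-1 * (1 + p%:R * q) ^+ 0 - 1) * R0 - 2 * ((4^-1 * (1 + p%:R * q) ^+ 1 - 1) * R1)
   + (4^-1 * (1 + p%:R * q) ^+ 2 - 1) * R2
   - 4^-1 * p%:R * q * (p%:R * q * R2 + 2 * (R2 - R1))) by field.
have eQ : Q0 = 2 * Q1 - Q2 + (0 + p%:R ^+ 2 * v) by rewrite -ev; ring.
by rewrite e0 e1 e2 es f2 eQ; field.
Qed.

(** * Power sums and Bernoulli numbers *)

Lemma bernoulliE n : n.+1%:R * bernoulli n =
  (n == 0%N)%:R - \sum_(k < n) 'C(n.+1, k)%:R * bernoulli k.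
Proof.
by rewrite -(bernoulli_rec n) big_ord_recr /= binSn addrAC subrr add0r.
Qed.

(** Up to this index the recurrence divides only by numbers below p. *)
Lemma bernoulli_int n : (n < p.-1)%N -> bernoulli n \in pint p.
Proof.
elim/ltn_ind: n => n IH lt.
have n0 : (n.+1%:R : rat) != 0 by rewrite pnatr_eq0.
rewrite -(mulKf n0 (bernoulli n)) bernoulliE; apply: rpredM.
  by apply: pint_inv_lt => //; lia.
rewrite rpredB ?rpred_nat //; apply: rpred_sum => k _.
by apply: rpredM; [exact: rpred_nat | apply: IH => //; have := ltn_ord k; lia].
Qed.

Lemma coprime_lt2 n : (0 < n < p + p)%N -> n != p -> coprime p n.
Proof.
move=> lt np; rewrite prime_coprime //; apply/negP => /dvdnP[[|[|k]] e];
  by move: lt np; rewrite e ?mulSn; lia.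
Qed.

(* Below 2p - 2, the recurrence divides by p only at the index p - 1. *)
Lemma p_bernoulli_int n : (n < (p + p).-2)%N -> p%:R * bernoulli n \in pint p.
Proof.
elim/ltn_ind: n => n IH lt.
have [e|ne] := eqVneq n p.-1.
  have := bernoulliE n; rewrite (_ : n.+1 = p); last by lia.
  move=> ->; rewrite rpredB ?rpred_nat //; apply: rpred_sum => k _.
  apply: rpredM; first exact: rpred_nat.
  by apply: bernoulli_int; rewrite -e.
have n0 : (n.+1%:R : rat) != 0 by rewrite pnatr_eq0.
rewrite -(mulKf n0 (bernoulli n)) bernoulliE mulrCA; apply: rpredM.
  by apply: pint_invn => //; apply: coprime_lt2; lia.
rewrite mulrBr mulr_sumr; apply: rpredB; first by pint.
apply: rpred_sum => k _; rewrite mulrCA.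
by apply: rpredM; [exact: rpred_nat | apply: IH => //; have := ltn_ord k; lia].
Qed.

Lemma psum_nat n : (0 < n)%N -> psum n = \sum_(0 <= k < p) (k%:R : rat) ^+ n.
Proof.
move=> n0; rewrite [RHS]big_ltn ?prime_gt0 // expr0n -[n == 0]negbK -lt0n n0 add0r.
by apply: eq_bigr => k _; rewrite exprnP.
Qed.

(** In Faulhaber's formula at N = p, the term j = n is (n+1) p B_n, and n + 1 is a unit. *)
Lemma psum_bernoulli m n : (0 < n)%N -> coprime p n.+1 ->
  (forall j, (j < n)%N -> cong p m (p%:R ^+ (n.+1 - j) * bernoulli j) 0) ->
  cong p m (psum n) (p%:R * bernoulli n).
Proof.
move=> n0 cn hj.
have u : (n.+1%:R : rat) != 0 by rewrite pnatr_eq0.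
have [z hz ez] : cong p m
    (\sum_(j < n) 'C(n.+1, j)%:R * bernoulli j * p%:R ^+ (n.+1 - j)) 0.
  elim/big_rec: _ => [|i x _ IH]; first exact: cong_refl.
  rewrite -[X in cong _ _ _ X]addr0; apply: cong_add => //.
  have [z hz ez] := hj i (ltn_ord i).
  exists ('C(n.+1, i)%:R * z); first by pint.
  by rewrite -mulrA [bernoulli i * _]mulrC ez; ring.
exists (n.+1%:R^-1 * z).
  by apply: rpredM => //; apply: pint_invn.
apply: (mulfI u); rewrite psum_nat // faulhaber big_ord_recr /= ez binSn.
rewrite subSnn expr1; move: u; move: (n.+1%:R : rat) => c u; by field.
Qed.

(** The reflection k -> p - k gives 2 P(n) = n p P(n-1) mod p^2 for odd n. *)
Lemma psum_odd n : (0 < n)%N -> odd n -> cong p 1 (psum n.-1) 0 ->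
  cong p 2 (psum n) 0.
Proof.
move=> n0 on [y hy ey].
have h2 := pint_inv2.
have r : psum n = - \sum_(1 <= k < p) k%:R ^ n%:Z * (1 - p%:R * k%:R^-1) ^ (- (- n%:Z)).
  rewrite -sumrN /psum big_nat_rev; apply: eq_big_nat => k /andP[k1 kp].
  have k0 := nat_neq0 k k1.
  rewrite opprK (_ : 1 + p - k.+1 = p - k)%N; last by lia.
  have -> : ((p - k)%N%:R : rat) = (-1) * (k%:R * (1 - p%:R * k%:R^-1)).
    by rewrite natrB ?(ltnW kp) //; field.
  by rewrite expfzMl -[(-1) ^ n]exprnP -signr_odd on expr1 mulN1r expfzMl.
have : cong p 2 (\sum_(1 <= k < p) k%:R ^ n%:Z * (1 - p%:R * k%:R^-1) ^ (- (- n%:Z)))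
    (psum n - n%:R * p%:R * psum n.-1).
  rewrite /psum mulr_sumr -sumrB big_nat [X in cong _ _ _ X]big_nat.
  apply: cong_sum => k kp; have k0 := nat_neq0 k (proj1 (andP kp)).
  have hk : (k%:R^-1 : rat) \in pint p by apply: pint_inv_lt.
  have [z hz ->] := neg_binom3 (- n%:Z) _ hk.
  have hn : (k%:R : rat) ^+ n \in pint p by pint.
  exists (k%:R ^+ n * ((- n%:R) * (- n%:R + 1) * 2^-1 * k%:R^-1 ^+ 2 + p%:R * z)).
    by rewrite [- _ * _ * _ * _]mulrA !mulNr; pint.
  rewrite -!exprnP rmorphN /= -pmulrn; case: n n0 {on r ey} hn => // n _ hn.
  by rewrite exprS /=; field.
case=> z hz ez.
exists (2^-1 * (n%:R * y - z)); first by pint.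
have e : psum n = 2^-1 * (psum n + psum n) by field.
by rewrite e {2}r ez ey; field.
Qed.

(** In Faulhaber's sum, terms with j <= n - 3 carry at least p^4, and p B_j is p-integral. For j = n
    - 2, P(n-2) = 0 mod p makes B_(n-2) p-integral; for j = n - 1, [psum_odd] gives p B_(n-1) = 0
    mod p^2. *)
Lemma psum_bernoulli3 n : (3 < n)%N -> (n < (p + p).-2)%N -> ~~ odd n ->
  coprime p n.+1 -> coprime p n -> coprime p n.-1 ->
  cong p 1 (psum n.-2) 0 -> cong p 3 (psum n) (p%:R * bernoulli n).
Proof.
(* From here [n] stands for the former n - 2. *)
case: n => [//|[//|n]] lt3 lt2p on c1 c2 c3 h; rewrite /= ?negbK in on c3 h.
have p0 := p_neq0.
have hi m j k : (j < (p + p).-2)%N -> (m < k)%N -> cong p m (p%:R ^+ k * bernoulli j) 0.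
  move=> jp mk; exists (p%:R ^+ (k - m).-1 * (p%:R * bernoulli j)).
    by have := p_bernoulli_int j jp => hb; pint.
  by rewrite add0r !mulrA -!exprD -exprSr; congr (_ ^+ _ * _); lia.
have b2 : bernoulli n \in pint p.
  have [z hz ez] : cong p 1 (p%:R * bernoulli n) 0.
    apply: cong_trans h; apply/cong_sym/psum_bernoulli; [lia | done |].
    by move=> j jn; apply: hi; lia.
  by rewrite (mulfI p0 (etrans ez _ : _ = p%:R * z)) // add0r expr1.
have [z hz ez] : cong p 2 (p%:R * bernoulli n.+1) 0.
  apply: cong_trans (psum_odd n.+1 isT on h).
  apply/cong_sym/psum_bernoulli; [done | done |].
  move=> j; rewrite ltnS leq_eqVlt => /predU1P[->|jn]; last by apply: hi; lia.
  by exists (bernoulli n) => //; rewrite add0r; congr (_ ^+ _ * _); lia.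
apply: psum_bernoulli => //.
move=> j; rewrite ltnS leq_eqVlt => /predU1P[->|].
  rewrite (_ : _ - _ = 2)%N; last by lia.
  exists z => //; rewrite expr2 -mulrA ez; ring.
rewrite ltnS leq_eqVlt => /predU1P[->|jn]; last by apply: hi; lia.
by exists (bernoulli n) => //; rewrite add0r; congr (_ ^+ _ * _); lia.
Qed.

Lemma psum_kexp_bernoulli j : (0 < j < 3)%N ->
  cong p 3 (psum (kexp j)) (p%:R * bernoulli (j * p.-1 - 2)).
Proof.
(* As 6 is not prime, p > 6, so the exponent p - 3 exceeds 3. *)
move=> jlt; have p7 : (6 < p)%N.
  by move: hp hp5; rewrite leq_eqVlt => pp /predU1P[e|//]; move: pp; rewrite -e.
have -> : kexp j = (j * p.-1 - 2)%N by rewrite /kexp; case: j jlt => [|[|[|]]] //; lia.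
have op : odd p by have [e|//] := even_prime hp; move: hp5; rewrite e.
(* The exponents p - 5 and 2p - 6 are -4 modulo p - 1. *)
have h4 i : cong p 1 (psum (- 4 + (i * p.-1)%N%:Z)) 0.
  elim: i => [|i IH]; first by rewrite mul0n addr0; apply: psum_neg4.
  apply: cong_trans IH; rewrite (_ : - 4 + (i.+1 * p.-1)%N%:Z =
    - 4 + (i * p.-1)%N%:Z + p.-1%:Z); last by lia.
  exact: psum_periodic.
apply: psum_bernoulli3.
- by case: j jlt => [|[|[|]]] //; lia.
- by case: j jlt => [|[|[|]]] //; lia.
- by case: j jlt => [|[|[|]]] //; lia.
- by apply: coprime_lt2; case: j jlt => [|[|[|]]] //; lia.
- by apply: coprime_lt2; case: j jlt => [|[|[|]]] //; lia.
- by apply: coprime_lt2; case: j jlt => [|[|[|]]] //; lia.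
- have := h4 j; congr (cong _ _ (psum _) _); case: j jlt => [|[|[|]]] //; lia.
Qed.

(** The second difference gives P(-2)/(-2) = p (2 B_(p-3)/(p-3) - B_(2p-4)/(2p-4)) mod p^3, and the
    right side is 2 p X_p. *)
Lemma psum_neg2_bernoulli : cong p 3 (psum (- 2)) (- 4 * p%:R * X_ p).
Proof.
have [z hz ez] := psum_second_difference.
have [z1 hz1 e1] := psum_kexp_bernoulli 1 isT.
have [z2 hz2 e2] := psum_kexp_bernoulli 2 isT.
have [u1 hi1] := pint_kexp 1 isT; have [u2 hi2] := pint_kexp 2 isT.
exists ((- 2) * (z + 2 * z1 * (kexp 1)%:~R^-1 - z2 * (kexp 2)%:~R^-1)).
  by rewrite mulNr; pint.
have k0 : (kexp 0)%:~R = - 2 :> rat by rewrite kexpE //; ring.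
have -> : psum (- 2) = (- 2) * (psum (kexp 0) / (kexp 0)%:~R).
  by rewrite k0 /kexp mul0n addr0; field.
set r0 := psum (kexp 0) / _ in ez *.
have -> : r0 = 0 + p%:R ^+ 3 * z + 2 * (psum (kexp 1) / (kexp 1)%:~R)
   - psum (kexp 2) / (kexp 2)%:~R by rewrite -ez; ring.
rewrite e1 e2 /X_ (_ : 1 * p.-1 - 2 = p - 3)%N; last by lia.
rewrite (_ : 2 * p.-1 - 2 = 2 * p - 4)%N; last by lia.
have k1 : (kexp 1)%:~R = p%:R - 3 :> rat by rewrite kexpE //; ring.
have k2 : (kexp 2)%:~R = 2 * p%:R - 4 :> rat by rewrite kexpE //; ring.
rewrite k1 k2 in u1 u2 *.
have -> : 4 * p%:R - 8 = 2 * (2 * p%:R - 4) :> rat by ring.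
by move: (bernoulli _) (bernoulli _) => b1 b2; field; rewrite u1 u2.
Qed.

(** * Evaluation of T_2 *)

Definition sdef (k : nat) : rat := (1 - sbin k) / p%:R.

Lemma sdefP k : (k < p)%N -> sdef k \in pint p /\ sbin k = 1 - p%:R * sdef k.
Proof.
move=> kp; have p0 := p_neq0; have [x hx e] := sbin_cong1 k kp.
have -> : sdef k = x by rewrite /sdef e; field.
by [].
Qed.

(** Second-order expansion of u_k^a = (1 - p s_k)^a, with s_k = [sdef k]. *)
Lemma tsum_quadratic (a : int) j : cong p 3 (tsum a j)
  (tsum 0 j - a%:~R * p%:R * (\sum_(1 <= k < p) sdef k * k%:R^-1 ^+ j)
   + a%:~R * (a%:~R - 1) / 2 * p%:R ^+ 2 * (\sum_(1 <= k < p) sdef k ^+ 2 * k%:R^-1 ^+ j)).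
Proof.
rewrite /tsum -mulNr 2!mulr_sumr -2!big_split /= big_nat [X in cong _ _ _ X]big_nat.
apply: cong_sum => k /andP[k1 kp]; have [hs es] := sdefP k kp.
have hk : (k%:R^-1 : rat) \in pint p by apply: pint_inv_lt; rewrite ?k1.
have [z hz ez] := neg_binom3 (- a) _ hs.
rewrite opprK -es in ez; exists (z * k%:R^-1 ^+ j); first by pint.
by rewrite {}ez expr0z rmorphN /=; move: (k%:R^-1 ^+ j) (sdef k) => w s; field.
Qed.

Lemma tsum_cong1 a j : cong p 1 (tsum a j) (psum (- j%:Z)).
Proof.
apply: cong_trans (cong_weaken _ 3 1 _ _ isT (tsum_quadratic a j)) _.
rewrite -tsum0.
have hsj i : \sum_(1 <= k < p) sdef k ^+ i * k%:R^-1 ^+ j \in pint p.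
  rewrite big_nat; apply: rpred_sum => k /andP[k1 kp]; have [hs _] := sdefP k kp.
  have hk : (k%:R^-1 : rat) \in pint p by apply: pint_inv_lt; rewrite ?k1.
  by pint.
have h1 := hsj 1%N; have h2 := hsj 2%N; have hi := pint_inv2.
exists (- a%:~R * (\sum_(1 <= k < p) sdef k ^+ 1 * k%:R^-1 ^+ j)
   + a%:~R * (a%:~R - 1) * 2^-1 * p%:R * (\sum_(1 <= k < p) sdef k ^+ 2 * k%:R^-1 ^+ j)).
  by rewrite mulNr; pint.
under [in RHS]eq_bigr do rewrite expr1.
by move: (tsum 0 j) (\sum_(_ <= _ < _) _ * _) (\sum_(_ <= _ < _) _ * _) => *; field.
Qed.

(** Newton interpolation at a = 0, 1, 2 eliminates the two sums over [sdef]. *)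
Lemma tsum_quadratic_interp (a : int) j : cong p 3 (tsum a j)
  (tsum 0 j + a%:~R * (tsum 1 j - tsum 0 j)
   + a%:~R * (a%:~R - 1) / 2 * (tsum 2 j - 2 * tsum 1 j + tsum 0 j)).
Proof.
have [z hz ->] := tsum_quadratic a j.
have [z1 hz1 ->] := tsum_quadratic 1 j; have [z2 hz2 ->] := tsum_quadratic 2 j.
have h2 := pint_inv2.
exists (z - a%:~R * z1 - a%:~R * (a%:~R - 1) * 2^-1 * (z2 - 2 * z1)); first by pint.
by move: (\sum_(_ <= _ < _) _ * _) (\sum_(_ <= _ < _) _ * _) (tsum 0 j) => *; field.
Qed.

(** * Reduction of S(a) to T_2 *)

Lemma tsum4_cong a : cong p 1 (tsum a 4) 0.
Proof. exact: cong_trans (tsum_cong1 a 4) psum_neg4. Qed.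

(** For odd j the reflection changes the sign: 2 T_3 = -(a+3) p T_4 mod p^2, and p divides T_4. *)
Lemma tsum3_cong a : cong p 2 (tsum a 3) 0.
Proof.
have [z hz] := cong_weaken _ 6 2 _ _ isT (tsum_rev a 3).
set e := (a + 3)%:~R; have he : e \in pint p := rpred_int _ _.
have [w hw ->] := tsum4_cong a.
have h2 := pint_inv2; have h3 := pint_inv3; have h5 := pint_inv5.
have := tsum_int a 5; have := tsum_int a 6; have := tsum_int a 7.
have := tsum_int a 8.
move: (tsum a 3) (tsum a 5) (tsum a 6) (tsum a 7) (tsum a 8).
move=> t3 t5 t6 t7 t8 h8 h7 h6 hh5 et.
exists (2^-1 * (z - e * w - e * (e + 1) * 2^-1 * t5
   - p%:R * e * (e + 1) * (e + 2) * 2^-1 * 3^-1 * t6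
   - p%:R ^+ 2 * e * (e + 1) * (e + 2) * (e + 3) * 2^-1 ^+ 3 * 3^-1 * t7
   - p%:R ^+ 3 * e * (e + 1) * (e + 2) * (e + 3) * (e + 4) * 2^-1 ^+ 3 * 3^-1
     * 5^-1 * t8)); first by pint.
have -> : t3 = 2^-1 * (t3 + t3) by field.
by rewrite {2}et; clearbody e; field.
Qed.

(** The reflection at j = 1, where p^2 T_3 and p^3 T_4 vanish mod p^4. *)
Lemma tsum1_cong a : cong p 4 (tsum a 1) (- (a%:~R + 1) / 2 * p%:R * tsum a 2).
Proof.
have [z hz] := cong_weaken _ 6 4 _ _ isT (tsum_rev a 1).
have -> : (a + 1)%:~R = a%:~R + 1 :> rat by rewrite rmorphD.
set e := a%:~R + 1; have he : e \in pint p by rewrite /e; pint.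
have [w hw ->] := tsum4_cong a; have [v hv ->] := tsum3_cong a.
have h2 := pint_inv2; have h3 := pint_inv3; have h5 := pint_inv5.
have := tsum_int a 5; have := tsum_int a 6.
move: (tsum a 1) (tsum a 2) (tsum a 5) (tsum a 6).
move=> t1 t2 t5 t6 h6 hh5 et.
exists (2^-1 * (z - e * (e + 1) * 2^-1 * v
   - e * (e + 1) * (e + 2) * 2^-1 * 3^-1 * w
   - e * (e + 1) * (e + 2) * (e + 3) * 2^-1 ^+ 3 * 3^-1 * t5
   - p%:R * e * (e + 1) * (e + 2) * (e + 3) * (e + 4) * 2^-1 ^+ 3 * 3^-1
     * 5^-1 * t6)); first by pint.
have -> : t1 = 2^-1 * (t1 + t1) by field.
by rewrite {2}et; clearbody e; field.
Qed.

(** Substituting T_1 in [ssum_cong] leaves the coefficient e(e+1)(e+2)/6 - e(e+1)^2/4 =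
    e(e+1)(1-e)/12 of p^3 T_2. *)
Lemma ssum_tsum2 a (e := a%:~R : rat) : cong p 6 (ssum a * (1 - e * p%:R))
  (p%:R * (1 - e) + e * (e + 1) * (1 - e) / 12 * p%:R ^+ 3 * tsum a 2).
Proof.
have [z hz ez] := ssum_cong a; rewrite -/e in ez.
have he : e \in pint p := rpred_int _ _.
have [w hw e4] := tsum4_cong a; have [v hv e3] := tsum3_cong a.
have [u hu e1] := tsum1_cong a; rewrite -/e in e1.
have h2 := pint_inv2; have h3 := pint_inv3; have h5 := pint_inv5.
exists (z + e * (e + 1) * 2^-1 * u
  + e * (e + 1) * (e + 2) * (e + 3) * 2^-1 ^+ 3 * 3^-1 * v
  + e * (e + 1) * (e + 2) * (e + 3) * (e + 4) * 2^-1 ^+ 3 * 3^-1 * 5^-1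
    * w); first by pint.
have -> : ssum a * (1 - e * p%:R) = ssum a - e * p%:R * ssum a by ring.
by rewrite {1}ez e4 e3 e1; clearbody e; move: (tsum a 2) (ssum a) => *; field.
Qed.

(** * T_2 at a = 1 and a = 2 *)

(** Wolstenholme's congruence, from T_1 = -p T_2 / 2 at a = 0. *)
Lemma psum_neg1_cong : cong p 2 (psum (- 1)) 0.
Proof.
have [z hz] := tsum1_cong 0; rewrite !tsum0.
have [w hw ->] := psum_neg2 => ->.
have h2 := pint_inv2.
by exists (- (2^-1 * w) + p%:R ^+ 2 * z); [pint | field].
Qed.

(** In [alt_bin2] at n = p - 1, the squared harmonic sum is divisible by p^4. *)
Lemma tsum_1_2 : cong p 3 (tsum 1 2) (- psum (- 2) / 2).
Proof.
have pp : p = p.-1.+1 by lia.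
have -> : tsum 1 2 = - (psum (- 1) ^+ 2 + psum (- 2)) / 2.
  rewrite -(tsum0 2) -(tsum0 1) /tsum.
  have <- : alt_bin p.-1 2 = \sum_(1 <= k < p) sbin k ^ 1 * k%:R^-1 ^+ 2.
    by rewrite /alt_bin -pp; apply: eq_bigr => k _; rewrite expr1z.
  rewrite alt_bin2 -pp; congr (- (_ ^+ 2 + _) / 2); apply: eq_bigr => k _;
  by rewrite expr0z mul1r.
have [z hz ->] := psum_neg1_cong; have h2 := pint_inv2.
by exists (- (2^-1 * p%:R * z ^+ 2)); [pint | field].
Qed.

(* The two factors are the products over 1 <= j <= m of 1 - p/j and of 1 + p/j. *)
Lemma sbin_mul_bin m : (m < p)%N ->
  cong p 6 (sbin m * 'C(p + m, m)%:R)
   (1 - p%:R ^+ 2 * (\sum_(1 <= k < m.+1) k%:R^-1 ^+ 2)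
    + p%:R ^+ 4 * ((\sum_(1 <= k < m.+1) k%:R^-1 ^+ 2) ^+ 2
                   - \sum_(1 <= k < m.+1) k%:R^-1 ^+ 4) / 2).
Proof.
have h2 := pint_inv2.
elim: m => [|m IH] mp.
  rewrite bin0 sbin0 !big_geq // (_ : _ + _ = 1 * 1); last by field.
  exact: cong_refl.
have [z hz ez] := IH (ltnW mp).
have hm : (m.+1%:R^-1 : rat) \in pint p by apply: pint_inv_lt.
have m0 : (m.+1%:R : rat) != 0 by rewrite pnatr_eq0.
(* One more factor (1 - p/(m+1)) (1 + p/(m+1)). The coefficient of p^4 is the second elementary
   symmetric function of the 1/k^2, in Newton's form. *)
have -> : sbin m.+1 * 'C(p + m.+1, m.+1)%:R =
    sbin m * 'C(p + m, m)%:R * (1 - p%:R ^+ 2 * m.+1%:R^-1 ^+ 2).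
  have := congr1 (fun n => n%:R : rat) (mul_bin_diag (p + m.+1) m).
  rewrite addnS /= !natrM -addnS natrD => e.
  have -> : 'C(p + m.+1, m.+1)%:R = (p%:R + m.+1%:R) * 'C(p + m, m)%:R / m.+1%:R :> rat.
    by rewrite e mulrC mulKf.
  rewrite sbinS //; move: m0.
  by move: (m.+1%:R : rat) ('C(p + m, m)%:R : rat) => *; field.
have hs j : \sum_(1 <= k < m.+1) (k%:R^-1 : rat) ^+ j \in pint p.
  rewrite big_nat; apply: rpred_sum => k /andP[k1 kp]; apply/rpredX/pint_inv_lt => //.
  by rewrite k1 /=; lia.
have ha := hs 2; have hb := hs 4.
rewrite ez ![\sum_(1 <= k < m.+2) _]big_nat_recr //=.
move: (m.+1%:R^-1) hm ha hb => h hm.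
move: (\sum_(1 <= k < m.+1) _ ^+ 2) (\sum_(1 <= k < m.+1) _ ^+ 4) => A B hA hB.
exists (z * (1 - p%:R ^+ 2 * h ^+ 2) - (A ^+ 2 - B) * 2^-1 * h ^+ 2); first by pint.
by field.
Qed.

(** The p^4 term drops out since p divides both P(-2) and P(-4). *)
Lemma central_bin : cong p 5 ('C(p + p.-1, p.-1)%:R) (1 - p%:R ^+ 2 * psum (- 2)).
Proof.
have pp : p = p.-1.+1 by lia.
have [z hz] : cong p 6 _ _ := sbin_mul_bin p.-1 ltac:(lia).
rewrite sbin_last // mul1r -pp => ->.
have E j : \sum_(1 <= k < p) k%:R^-1 ^+ j = psum (- j%:Z).
  by rewrite -tsum0; apply: eq_bigr => k _; rewrite expr0z mul1r.
rewrite !E; have [v hv e4] := psum_neg4; rewrite e4.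
have [w hw ->] := psum_neg2; have h2 := pint_inv2.
exists (2^-1 * (p%:R * w ^+ 2 - v) + p%:R * z); first by pint.
by field.
Qed.

Lemma ssum2 : ssum 2 * (2 * p%:R - 1) = p%:R * 'C(p + p.-1, p.-1)%:R.
Proof.
have -> : ssum 2 = 'C(p.-1 + p.-1, p.-1)%:R.
  rewrite -binomial.Vandermonde natr_sum /ssum big_mkord -[in LHS](ltn_predK hp5).
  apply: eq_bigr => k _; rewrite bin_sub; last by have := ltn_ord k; lia.
  by rewrite -exprnP /sbin exprMn sqrr_sign mul1r natrM expr2.
have := congr1 (fun n => n%:R : rat) (mul_bin_diag (p + p.-1) p.-1).
rewrite (_ : (p + p.-1).-1 = p.-1 + p.-1)%N; last by lia.
rewrite (_ : p.-1.+1 = p)%N; last by lia.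
rewrite (_ : 'C(p + p.-1, p) = 'C(p + p.-1, p.-1)); last first.
  by rewrite -bin_sub; [congr 'C(_, _); lia | lia].
rewrite !natrM natrD p1E // => <-; ring.
Qed.

(** Both [ssum_tsum2] and [ssum2] evaluate (1 - 2p) S(2) mod p^6: as -p - p^3 T_2(2)/2 and as -p +
    p^3 H. Dividing by p^3 leaves precision p^3. *)
Lemma tsum_2_2 : cong p 3 (tsum 2 2) (- 2 * psum (- 2)).
Proof.
have p0 := p_neq0.
have [z hz ez] := ssum_tsum2 2; have [w hw ew] := central_bin.
exists (2 * (z + w)); first by pint.
have e : p%:R * 'C(p + p.-1, p.-1)%:R = - (ssum 2 * (1 - 2%:~R * p%:R)).
  by rewrite -ssum2; ring.
rewrite ez ew in e.
have p3 : (p%:R ^+ 3 : rat) != 0 by rewrite expf_neq0.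
apply: (mulfI p3).
have -> : p%:R ^+ 3 * tsum 2 2 = 2 * (- (p%:R * (1 - 2%:~R) +
    2%:~R * (2%:~R + 1) * (1 - 2%:~R) / 12 * p%:R ^+ 3 * tsum 2 2
    + p%:R ^+ 6 * z)) - 2 * p%:R + 2 * p%:R ^+ 6 * z by field.
by rewrite -e; ring.
Qed.

(** The values H, -H/2, -2H are in arithmetic progression, so T_2(a) = H (1 - 3a/2), where H = -4 p
    X_p. *)
Lemma tsum2_cong a : cong p 3 (tsum a 2) (2 * (3 * a%:~R - 2) * p%:R * X_ p).
Proof.
have [z hz ->] := tsum_quadratic_interp a 2.
rewrite (tsum0 2); have [z1 hz1 ->] := tsum_1_2; have [z2 hz2 ->] := tsum_2_2.
have [w hw ->] := psum_neg2_bernoulli.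
have h2 := pint_inv2.
exists (z + (1 - 3 * a%:~R * 2^-1) * w + a%:~R * z1
   + a%:~R * (a%:~R - 1) * 2^-1 * (z2 - 2 * z1)); first by pint.
by field.
Qed.

(** * The congruence for S(a) *)

(** Inserts T_2(a) in [ssum_tsum2] and divides by the unit 1 - a p. *)
Lemma ssum_congruence (a : int) (e := a%:~R : rat) : cong p 6 (ssum a)
  ((e - 1) * p%:R / (e * p%:R - 1)
     * (1 + e * (e + 1) * (3 * e - 2) / 6 * p%:R ^+ 3 * X_ p)).
Proof.
have he : e \in pint p := rpred_int _ _.
have [z hz ez] := ssum_tsum2 a; rewrite -/e in ez.
have [w hw ew] := tsum2_cong a; rewrite -/e in ew.
have [u0 hu] := one_sub_unit _ he.
have h2 := pint_inv2; have h3 := pint_inv3.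
exists ((1 - p%:R * e)^-1 * (z + e * (e + 1) * (1 - e) * 2^-1 ^+ 2 * 3^-1 * w)).
  by pint.
apply: (mulIf u0); rewrite (mulrC p%:R) ez ew; field.
rewrite [p%:R * _]mulrC in u0; by rewrite u0 -opprB oppr_eq0 u0.
Qed.

End Prime.

Theorem theorem1p1 (p : nat) (hp : prime p) (hp5 : (5 < p)%N) (a : int) :
  eqmod_ppow p 6
    (\sum_(0 <= k < p) (-1 : rat) ^ (a * k%:Z) * ('C(p.-1, k)%:R : rat) ^ a)
    ((a%:~R - 1) * p%:R / (a%:~R * p%:R - 1)
     * (1 + a%:~R * (a%:~R + 1) * (3%:R * a%:~R - 2%:R) / 6%:R
            * p%:R ^+ 3 * X_ p)).
Proof.
have -> : \sum_(0 <= k < p) (-1 : rat) ^ (a * k%:Z) * ('C(p.-1, k)%:R : rat) ^ a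
    = ssum p a.
  apply: eq_bigr => k _; rewrite /sbin expfzMl; congr (_ * _).
  by rewrite exprnP exprz_exp mulrC.
by apply: cong_padic_val => //; apply: ssum_congruence.
Qed.
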